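(* If a compact space $Y$ is I-favorable, then the hyperspace $\exp(Y)$ with the Vietoris topology is universally Kuratowski-Ulam$^*$ (uK-U$^*$).
   Context: A set is meager (of first category) if it is a countable union of nowhere dense sets. The game on a topological space $X$: two players play rounds $n=0,1,2,\ldots$. At round $n$, Player I chooses a finite family $\mathcal{A}_n$ of non-empty open subsets of $X$; then Player II chooses a finite family $\mathcal{B}_n$ of non-empty open subsets of $X$ such that for each $U\in\mathcal{A}_n$ there exists $V\in\mathcal{B}_n$ with $V\subseteq U$. Player I wins if for every natural number $k$ the union $\bigcup(\mathcal{B}_k\cup\mathcal{B}_{k+1}\cup\ldots)$ is dense in $X$; otherwise Player II wins. The space $X$ is I-favorable if Player I has a winning strategy, i.e. a function $\sigma$ assigning to each finite sequence $(\mathcal{B}_0,\ldots,\mathcal{B}_n)$ (including the empty sequence) of finite families of non-empty open sets a finite family $\sigma(\mathcal{B}_0,\ldots,\mathcal{B}_n)$ of non-empty open sets, such that Player I wins every game in which $\mathcal{A}_0=\sigma(\emptyset)$ and $\mathcal{A}_{n+1}=\sigma(\mathcal{B}_0,\ldots,\mathcal{B}_n)$ for all $n$. The hyperspace $\exp(Y)$ is the set of all non-empty closed subsets of $Y$; the Vietoris topology on it has as a base the sets $\langle V_1,\ldots,V_n\rangle=\{A\in\exp(Y): A\subseteq V_1\cup\cdots\cup V_n\text{ and }A\cap V_i\neq\emptyset\text{ for }1\leq i\leq n\}$, where $n\geq 1$ and $V_1,\ldots,V_n$ are open subsets of $Y$. A space $Z$ is universally Kuratowski-Ulam$^*$ (uK-U$^*$)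 if for every topological space $X$ and every nowhere dense set $E\subseteq X\times Z$ (product topology), the set $\{x\in X:\{z\in Z:(x,z)\in E\}\text{ is not nowhere dense in }Z\}$ is meager in $X$.
   Formalization: The compact space Y is additionally assumed to be T1 (as holds when compact spaces are taken to be Hausdorff); without any separation axiom the claim fails. *)

(* Defs.v *)
From HB Require Import structures.
From mathcomp Require Import all_boot all_classical topology.

Set Implicit Arguments.
Unset Strict Implicit.
Unset Printing Implicit Defensive.

Local Open Scope classical_set_scope.

Definition nowhere_dense (X : topologicalType) (A : set X) : Prop :=
  interior (closure A) = set0.

Definition meager (X : topologicalType) (A : set X) : Prop :=
  exists F : nat -> set X,
    (forall n, nowhere_dense (F n)) /\ A = \bigcup_n F n.

Definition open_family (X : topologicalType) (A : set (set X)) : Prop :=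
  finite_set A /\ (forall U, A U -> open U /\ U !=set0).

Definition refines (X : topologicalType) (B A : set (set X)) : Prop :=
  forall U, A U -> exists2 V, B V & V `<=` U.

(* [B n] is the family chosen by Player II at round [n]. *)
Definition I_wins (X : topologicalType) (B : nat -> set (set X)) : Prop :=
  forall k, dense (\bigcup_(n in [set n | (k <= n)%N]) \bigcup_(V in B n) V).

(* A strategy is a total function on sequences of arbitrary families of sets,
   but only its values on sequences of legal moves matter. *)
Definition strategy (X : topologicalType)
    (sigma : seq (set (set X)) -> set (set X)) : Prop :=
  forall s : seq (set (set X)),
    (forall B, B \in s -> open_family B) -> open_family (sigma s).

(* [mkseq B n] is [B 0, ..., B (n - 1)], so Player I opens with
   [sigma [::]]. *)
Definition winning_strategy (X : topologicalType)
    (sigma : seq (set (set X)) -> set (set X)) : Prop :=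
  strategy sigma /\
  forall B : nat -> set (set X),
    (forall n, open_family (B n) /\ refines (B n) (sigma (mkseq B n))) ->
    I_wins B.

Definition I_favorable (X : topologicalType) : Prop :=
  exists sigma : seq (set (set X)) -> set (set X), winning_strategy sigma.

(* Singletons are points of the hyperspace only when [Y] is T1; otherwise the
   basic set <V> defined below may be empty for a non-empty open set V. *)
Record hyperspace (Y : topologicalType) := Hyperspace {
  hyperspace_set :> set Y;
  hyperspace_closed : closed hyperspace_set;
  hyperspace_nonempty : hyperspace_set !=set0 }.

HB.instance Definition _ (Y : topologicalType) := gen_eqMixin (hyperspace Y).
HB.instance Definition _ (Y : topologicalType) :=
  gen_choiceMixin (hyperspace Y).

Section Vietoris.
Variable Y : topologicalType.

(* <V_1, ..., V_n> depends only on the set {V_1, ..., V_n}. *)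
Definition vietoris_base (V : set (set Y)) : set (hyperspace Y) :=
  [set A : hyperspace Y | (A : set Y) `<=` \bigcup_(U in V) U /\
     forall U, V U -> (A : set Y) `&` U !=set0].

(* Non-emptiness of [V] is the condition n >= 1. *)
Definition vietoris_index : set (set (set Y)) :=
  [set V | [/\ finite_set V, V !=set0 & forall U, V U -> open U]].

Lemma vietoris_cover :
  \bigcup_(V in vietoris_index) vietoris_base V = [set: hyperspace Y].
Proof.
apply/seteqP; split => // A _; exists [set setT].
  split; [exact: finite_set1 | by exists setT | by move=> U ->; exact: openT].
split; first by move=> x _; exists setT.
by move=> U ->; rewrite setIT; exact: hyperspace_nonempty.
Qed.

Lemma vietoris_join (V W : set (set Y)) (A : hyperspace Y) :
  vietoris_index V -> vietoris_index W ->
  vietoris_base V A -> vietoris_base W A ->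
  exists T, [/\ vietoris_index T, vietoris_base T A &
    vietoris_base T `<=` vietoris_base V `&` vietoris_base W].
Proof.
move=> [Vfin [V0 VV0] Vop] [Wfin [W0 WW0] Wop] [AV AmV] [AW AmW].
pose oV := \bigcup_(U in V) U; pose oW := \bigcup_(U in W) U.
exists ([set U `&` oW | U in V] `|` [set U `&` oV | U in W]); split.
- split.
  + by rewrite finite_setU; split; exact: finite_image.
  + by exists (V0 `&` oW); left; exists V0.
  + by move=> _ [[U VU <-]|[U WU <-]]; apply: openI;
      [exact: Vop | exact: bigcup_open | exact: Wop | exact: bigcup_open].
- split.
  + move=> x Ax; have [U VU Ux] := AV x Ax.
    by exists (U `&` oW); [left; exists U | split => //; exact: AW].
  + move=> _ [[U VU <-]|[U WU <-]].
    * by have [x [Ax Ux]] := AmV U VU; exists x; split => //; split => //;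
        exact: AW.
    * by have [x [Ax Ux]] := AmW U WU; exists x; split => //; split => //;
        exact: AV.
- move=> B [BT BmT]; split; split.
  + by move=> x /BT[_ [[U VU <-] [Ux _]|[U WU <-] [_ //]]]; exists U.
  + move=> U VU; have [|x [Bx [Ux _]]] := BmT (U `&` oW); last by exists x.
    by left; exists U.
  + by move=> x /BT[_ [[U VU <-] [_ //]|[U WU <-] [Ux _]]]; exists U.
  + move=> U WU; have [|x [Bx [Ux _]]] := BmT (U `&` oV); last by exists x.
    by right; exists U.
Qed.

HB.instance Definition _ := isBaseTopological.Build (hyperspace Y)
  vietoris_cover vietoris_join.

End Vietoris.

Definition uKU_star (Z : topologicalType) : Prop :=
  forall (X : topologicalType) (E : set (X * Z)),
    nowhere_dense E ->
    meager [set x : X | ~ nowhere_dense [set z : Z | E (x, z)]].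

(* Main.v *)
(* An I-favorable space Z is uK-U*: given a nowhere dense E in X x Z, let
   Player II answer the winning strategy by sets whose products with some
   open subset of X miss E. Organising these answers along a tree of disjoint
   open families in X, almost every x determines a whole game, and the dense
   union of its moves misses the section E_x.

   The hyperspace of an I-favorable T1 space is I-favorable. If a family P of
   open sets of Y is closed under the strategy, then every non-empty open set
   V is met by all members of P below some W in P. So Player I, adding Player
   II's answers along the way, builds such a countable P, closed also under
   non-empty intersections, and plays the sets <U_1, ..., U_n> with U_i in P.
   Given <V_1, ..., V_n>, choose U_i in P for V_i as above: any answer below
   <U_1, ..., U_n> meets <V_1, ..., V_n>, since finite sets are points of the
   hyperspace. *)

Require Import Defs.
From mathcomp Require Import all_boot finmap all_classical topology.

Set Implicit Arguments.
Unset Strict Implicit.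
Unset Printing Implicit Defensive.

Local Open Scope classical_set_scope.

(** * Finite families and finite sequences *)

Lemma finite_powerset (T : choiceType) (A : set T) :
  finite_set A -> finite_set [set B | B `<=` A].
Proof.
move=> Afin.
apply: (@sub_finite_set _ _
  [set [set` F] | F in [set` fpowerset (fset_set A)]]).
  move=> B /= BA; have Bfin := sub_finite_set BA Afin.
  exists (fset_set B); last exact: fset_setK.
  by rewrite /= fpowersetE -fset_set_sub.
exact/finite_image/finite_fset.
Qed.

Definition bounded_seqs (T : eqType) (n : nat) (A : set T) : set (seq T) :=
  [set t | (size t <= n)%N /\ forall a, a \in t -> A a].

Lemma finite_bounded_seqs (T : eqType) (n : nat) (A : set T) :
  finite_set A -> finite_set (bounded_seqs n A).
Proof.
move=> Afin; elim: n => [|n IHn].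
  apply: (@sub_finite_set _ _ [set [::]]); last exact: finite_set1.
  by move=> t [+ _]; rewrite leqn0 size_eq0 => /eqP.
apply: (@sub_finite_set _ _
  ([set [::]] `|` [set a :: t | a in A & t in bounded_seqs n A])).
  move=> [|a t] [tn tA]; first by left.
  right; exists a; first by apply: tA; rewrite mem_head.
  by exists t => //; split => // b bt; apply: tA; rewrite in_cons bt orbT.
by rewrite finite_setU; split; [exact: finite_set1 | exact: finite_image2].
Qed.

Lemma seq_nondecreasing_property (T : eqType) (Q : nat -> T -> Prop)
    (t : seq T) :
  (forall m n a, (m <= n)%N -> Q m a -> Q n a) ->
  (forall a, a \in t -> exists n, Q n a) ->
  exists n, forall a, a \in t -> Q n a.
Proof.
move=> mon; elim: t => [|a t IHt] Qt; first by exists 0.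
have [n Qn] := IHt (fun b bt => Qt b (mem_behead (s := a :: t) bt)).
have [m Qm] := Qt a (mem_head a t).
exists (maxn m n) => b; rewrite in_cons => /predU1P[->|/Qn].
  exact: mon (leq_maxl _ _) Qm.
exact: mon (leq_maxr _ _).
Qed.

Lemma finite_subset_nondecreasing_bigcup (T : eqType) (P : nat -> set T)
    (F : set T) :
  (forall m n, (m <= n)%N -> P m `<=` P n) -> finite_set F ->
  F `<=` \bigcup_n P n -> exists n, F `<=` P n.
Proof.
move=> mon /finite_seqP[t ->] tP.
apply: (seq_nondecreasing_property (Q := P)) => [m n a /mon|a /tP[n _]].
  exact.
by exists n.
Qed.

(** Lets Player II's answers be defined from the whole play so far. *)
Lemma course_of_values (T : Type) (g : seq T -> T) :
  exists B : nat -> T, forall n, B n = g (mkseq B n).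
Proof.
pose hist n := iter n (fun s => rcons s (g s)) [::].
exists (fun n => g (hist n)) => n; congr g.
by elim: n => // n IHn; rewrite mkseqS -IHn.
Qed.

(** * Nowhere dense sets in products and winning strategies *)

Lemma nowhere_dense_disjoint_dense_open (T : topologicalType) (D F : set T) :
  open D -> dense D -> F `<=` ~` D -> nowhere_dense F.
Proof.
move=> oD dD FD; apply/seteqP; split => // x xF.
have [y [yF Dy]] := dD _ (ex_intro _ x xF) (open_interior _).
have /(_ y (interior_subset yF)) : closure F `<=` ~` D; last by [].
by rewrite (proj1 (closure_id (~` D)) (open_closedC oD)); exact: closureS.
Qed.

(** The box over [W] and [U] cannot lie in [closure E]; a basic neighbourhood of a point outside the
    closure, cut down to that box, gives [W'] and [V]. *)
Lemma nowhere_dense_box (X Z : topologicalType) (E : set (X * Z))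
    (W : set X) (U : set Z) :
  nowhere_dense E -> open W -> W !=set0 -> open U -> U !=set0 ->
  exists W' V, [/\ open W', W' !=set0, W' `<=` W &
    [/\ open V, V !=set0, V `<=` U & W' `*` V `<=` ~` E]].
Proof.
move=> ndE oW [x Wx] oU [z Uz].
have oWU : open (W `*` U).
  rewrite openE => -[x1 z1] [/= Wx1 Uz1]; exists (W, U) => //.
  by split; apply: open_nbhs_nbhs.
have [[x1 z1] [[/= Wx1 Uz1] nE1]] : (W `*` U) `&` ~` closure E !=set0.
  apply/set0P/eqP => WUE.
  have : W `*` U `<=` interior (closure E).
    rewrite -open_subsetE // => p WUp; apply: contrapT => nEp.
    by suff : set0 p by []; rewrite -WUE.
  by rewrite ndE => /(_ (x, z)); apply.
have : nbhs (x1, z1) ((W `*` U) `&` ~` closure E).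
  apply: open_nbhs_nbhs; split => //; apply: openI => //.
  exact/closed_openC/closed_closure.
move=> [[A B] /= [A1 B1] AB].
exists (interior A `&` W), (interior B `&` U); split.
- by apply: openI => //; exact: open_interior.
- by exists x1; split.
- by move=> ? [].
split.
- by apply: openI => //; exact: open_interior.
- by exists z1; split.
- by move=> ? [].
move=> [p q] [/= [Ap _] [Bq _]] Epq.
have [_] : ((W `*` U) `&` ~` closure E) (p, q).
  by apply: AB; split; exact: interior_subset.
by apply; exact: subset_closure.
Qed.

(** [W] shrinks once for each member of [A]; boxes found earlier still miss [E] after shrinking. *)
Lemma nowhere_dense_box_family (X Z : topologicalType) (E : set (X * Z))
    (W : set X) (A : set (set Z)) :
  nowhere_dense E -> open W -> W !=set0 -> open_family A ->
  exists W' B, [/\ open W', W' !=set0 & W' `<=` W] /\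
    [/\ open_family B, refines B A & forall V, B V -> W' `*` V `<=` ~` E].
Proof.
move=> ndE oW W0 [/finite_seqP[t ->]].
elim: t => [|U t IHt] tA.
  exists W, set0; split; first by split.
  by split => //; split.
have [|W1 [B [[oW1 W10 W1W] [[Bfin Bo] Bref BE]]]] := IHt.
  by move=> V Vt; apply: tA; rewrite /= in_cons (Vt : V \in t) orbT.
have [oU U0] := tA U (mem_head U t).
have [W2 [V [oW2 W20 W21 [oV V0 VU VE]]]] :=
  nowhere_dense_box ndE oW1 W10 oU U0.
exists W2, (V |` B); split.
  by split => //; exact: subset_trans W1W.
split.
- split; first by rewrite finite_setU; split => //; exact: finite_set1.
  by move=> V' [->|/Bo].
- move=> U' /=; rewrite in_cons => /predU1P[->|/Bref[V' BV' V'U']].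
    by exists V; first left.
  by exists V'; first right.
- move=> V' [->//|/BE WE] [p q] [/= W2p V'q].
  by apply: WE; split => //; exact: W21.
Qed.

(* The witness is chosen once per member of a maximal disjoint family of
   open sets, which is why it can be taken locally constant. *)
Lemma locally_constant_witness (X : topologicalType) (T : Type)
    (Q : X -> T -> Prop) :
  (forall W : set X, open W -> W !=set0 ->
    exists W' t, [/\ open W', W' !=set0, W' `<=` W &
      forall x, W' x -> Q x t]) ->
  exists (D : set X) (h : X -> T), [/\ open D, dense D &
    forall x, D x -> Q x (h x) /\
      exists2 U, open_nbhs x U & forall y, U y -> h y = h x].
Proof.
move=> QW.
pose good := [set i : set X * T |
  [/\ open i.1, i.1 !=set0 & forall x, i.1 x -> Q x i.2]].
have [M [Mgood Mdisj Mmax]] := ex_maximal_disjoint_subcollection fst good.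
(* Members of [M] that share the point [x] are equal, so the witness at [x] is unique. Off the union
   any value will do, and [QW] on the whole space supplies one. *)
have /choice[h hM] : forall x, exists t, forall i, M i -> i.1 x -> i.2 = t.
  move=> x; have [[i [Mi ix]]|nM] := pselect (exists i, M i /\ i.1 x).
    by exists i.2 => j Mj jx; rewrite (Mdisj j i Mj Mi) //; exists x.
  have [_ [t _]] := QW _ openT (ex_intro _ x I).
  by exists t => i Mi ix; case: nM; exists i.
exists (\bigcup_(i in M) i.1), h; split.
- by apply: bigcup_open => i /Mgood[].
(* An open set missing the union would contain a good set extending [M], against maximality. *)
- move=> O O0 oO; apply: contrapT => nO.
  have [W [t [oW W0 WO Wt]]] := QW O oO O0.
  have WM i : M i -> W `&` i.1 = set0.
    move=> Mi; apply/seteqP; split => // x [/WO Ox ix].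
    by apply: nO; exists x; split => //; exists i.
  apply: (Mmax ((W, t) |` M)).
  + split; first by move=> ?; right.
    move=> /(_ _ (or_introl erefl))/WM /=; rewrite setIid => W_0.
    by case: W0 => x; rewrite W_0.
  + by move=> i [->|/Mgood//]; split.
  + move=> i j [->|Mi] [->|Mj] //.
    * by rewrite WM // => -[].
    * by rewrite setIC WM // => -[].
    * exact: Mdisj.
- move=> x [i Mi ix]; have [oi _ iQ] := Mgood i Mi.
  rewrite -(hM x i Mi ix); split; first exact: iQ.
  by exists i.1 => // y iy; rewrite (hM y i Mi iy).
Qed.

Theorem I_favorable_uKU_star (Z : topologicalType) :
  I_favorable Z -> uKU_star Z.
Proof.
move=> [sigma [sigmaP win]] X E ndE.
pose legal (s : seq (set (set Z))) := forall B, B \in s -> open_family B.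
(* A level of the tree is encoded as a dense open set with a map, locally constant on it, giving the
   history of Player II's moves at each point. *)
pose good (p : set X * (X -> seq (set (set Z)))) :=
  [/\ open p.1, dense p.1 & forall x, p.1 x -> legal (p.2 x) /\
    exists2 U, open_nbhs x U & forall y, U y -> p.2 y = p.2 x].
pose answer x s t := exists B, [/\ t = rcons s B, open_family B,
  refines B (sigma s) & forall V z, B V -> V z -> ~ E (x, z)].
have /choice[next nextP] : forall p, exists p', good p ->
    good p' /\ forall x, p'.1 x -> answer x (p.2 x) (p'.2 x).
  move=> p; have [[oD dD hD]|ngp] := pselect (good p); last by exists p.
  case: p => D h /= in oD dD hD *.
  have [|D' [h' [oD' dD' h'D']]] := @locally_constant_witness X _
      (fun x t => legal t /\ answer x (h x) t).
    move=> W oW W0; have [x [Wx Dx]] := dD W W0 oW.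
    have [lx [U [oU Ux] hU]] := hD x Dx.
    (* The history is constant on [U], so one answer to [sigma (h x)] serves all of [W']. *)
    have [|||W' [B [[oW' W'0 W'WU] [Bo Bref BE]]]] :=
        @nowhere_dense_box_family _ _ E (W `&` U) (sigma (h x)) ndE.
    - exact: openI.
    - by exists x.
    - exact: sigmaP.
    exists W', (rcons (h x) B); split => //; first by move=> y /W'WU[].
    move=> y W'y; split.
      by move=> C; rewrite mem_rcons in_cons => /predU1P[->//|/lx].
    exists B; have [_ Uy] := W'WU y W'y; rewrite (hU y Uy); split => //.
    by move=> V z BV Vz; apply: (BE V BV (y, z)); split.
  exists (D', h') => _; split; last by move=> x /h'D'[[_]].
  by split => // x /h'D'[[]].
pose st n := iter n next (setT, fun=> [::]).
have st_good n : good (st n).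
  elim: n => [|n /nextP[]//]; split => /=; first exact: openT.
    by move=> O O0 _; rewrite setIT.
  by move=> x _; split => //; exists setT => //; split => //; exact: openT.
have st_answer n x : (st n.+1).1 x -> answer x ((st n).2 x) ((st n.+1).2 x).
  by have [_] := nextP _ (st_good n); exact.
have covered x : (forall n, (st n).1 x) -> nowhere_dense [set z | E (x, z)].
  (* The default [set0] is never read: by [st_answer] this history is an [rcons]. *)
  move=> stx; pose B n := last set0 ((st n.+1).2 x).
  have stB n : (st n).2 x = mkseq B n.
    elim: n => // n IHn; rewrite mkseqS -IHn /B.
    by have [C [-> _ _ _]] := st_answer n x (stx n.+1); rewrite last_rcons.
  have BP n : [/\ open_family (B n), refines (B n) (sigma (mkseq B n)) &
      forall V z, B n V -> V z -> ~ E (x, z)].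
    rewrite -stB /B; have [C [-> Co Cref CE]] := st_answer n x (stx n.+1).
    by rewrite last_rcons.
  have /win/(_ 0) dB : forall n,
      open_family (B n) /\ refines (B n) (sigma (mkseq B n)).
    by move=> n; have [] := BP n.
  apply: nowhere_dense_disjoint_dense_open dB _.
    apply: bigcup_open => n _; apply: bigcup_open => V.
    by have [[_ Bo] _ _] := BP n => /Bo[].
  move=> z Exz [n _ [V BV Vz]].
  by have [_ _ BE] := BP n; exact: BE BV Vz Exz.
(* [meager] asks for equality with the union, so the complement of each level is cut down to the bad
   points; by [covered], each bad point is off some level. *)
exists (fun n => [set x | ~ nowhere_dense [set z | E (x, z)]] `\` (st n).1).
split.
  move=> n; have [oD dD _] := st_good n.
  by apply: nowhere_dense_disjoint_dense_open oD dD _ => x [].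
apply/seteqP; split => [x /= bad|x [n _ []//]].
apply: contrapT => nx; apply: (bad); apply: covered => n.
by apply: contrapT => nDx; apply: nx; exists n.
Qed.

(* Otherwise Player II could answer the strategy inside [P] by sets missing
   [V]. *)
Lemma winning_strategy_closed_family (X : topologicalType)
    (sigma : seq (set (set X)) -> set (set X)) (P : set (set X)) (V : set X) :
  winning_strategy sigma ->
  (forall U, P U -> open U /\ U !=set0) ->
  (forall t, (forall F, F \in t -> finite_set F /\ F `<=` P) ->
    sigma t `<=` P) ->
  open V -> V !=set0 ->
  exists2 W, P W & forall U, P U -> U `<=` W -> U `&` V !=set0.
Proof.
move=> [sigmaP win] Po Psigma oV V0; apply: contrapT => nW.
have /choice[r rP] : forall W, exists U,
    P W -> [/\ P U, U `<=` W & U `&` V = set0].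
  move=> W; have [PW|] := pselect (P W); last by exists W.
  apply: contrapT => nU; apply: nW; exists W => // U PU UW.
  by apply/set0P/eqP => UV; apply: nU; exists U.
have [B BE] := course_of_values (fun s => r @` sigma s).
(* [r] is controlled only on [P], so the play must stay in [P]: [Psigma] keeps Player I's moves
   there, and [r] then keeps the answers there. *)
have histP n F : F \in mkseq B n -> finite_set F /\ F `<=` P.
  elim: n F => // n IHn F.
  rewrite mkseqS mem_rcons in_cons => /predU1P[->|]; last exact: IHn.
  rewrite BE; split.
    apply: finite_image; have [|//] := sigmaP (mkseq B n).
    by move=> C /IHn[Cfin CP]; split => // U /CP/Po.
  by move=> _ [W sW <-]; have [] := rP W (Psigma _ IHn _ sW).
have BP n : finite_set (B n) /\ B n `<=` P.
  by apply: (histP n.+1); rewrite mkseqS mem_rcons mem_head.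
have /win/(_ 0)/(_ V V0 oV)[x [Vx [n _ [U BU Ux]]]] : forall n,
    open_family (B n) /\ refines (B n) (sigma (mkseq B n)).
  move=> n; split; first by split; [apply BP | move=> U /(BP n).2/Po].
  move=> W sW; have [_ rW _] := rP W (Psigma _ (histP n) _ sW).
  by exists (r W) => //; rewrite BE; exists W.
rewrite BE in BU; case: BU => W sW WU.
have [_ _ rV] := rP W (Psigma _ (histP n) _ sW).
by have : set0 x by rewrite -rV WU.
Qed.

(** * Basic sets of the Vietoris topology over a T1 space *)

Lemma vietoris_base_open (Y : topologicalType) (V : set (set Y)) :
  vietoris_index V -> open (vietoris_base V).
Proof. by move=> Vi; exists [set V]; [move=> ? -> | rewrite bigcup_set1]. Qed.

Lemma vietoris_open_base (Y : topologicalType) (O : set (hyperspace Y)) :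
  open O -> O !=set0 -> exists V, [/\ vietoris_index V,
    vietoris_base V !=set0 & vietoris_base V `<=` O].
Proof.
move=> [D DI <-] [A [V DV VA]]; exists V; split; [exact: DI | by exists A |].
by move=> B VB; exists V.
Qed.

Section FiniteSubsets.
Variable Y : topologicalType.
Hypothesis T1 : accessible_space Y.
Implicit Types C V W : set (set Y).

Lemma finite_hyperspace (S : set Y) : finite_set S -> S !=set0 ->
  exists A : hyperspace Y, A = S :> set Y.
Proof.
move=> Sfin S0.
by exists (Hyperspace (accessible_finite_set_closed.1 T1 S Sfin) S0).
Qed.

(** Tested on finite sets. If no member of [V] lies in [G], one point outside [G] from each member
    forms a point of the first basic set missing [G]. For the covering, add [x] to a choice of one
    point per member. *)
Lemma vietoris_base_subset V C : finite_set V -> V !=set0 ->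
  (forall U, V U -> U !=set0) -> vietoris_base V `<=` vietoris_base C ->
  refines V C /\ forall U, V U -> U `<=` \bigcup_(G in C) G.
Proof.
move=> Vfin [V0 VV0] Vn0 VC; split.
  move=> G CG; apply: contrapT => nG.
  have /choice[f fP] : forall U, exists x, V U -> U x /\ ~ G x.
    move=> U; have [VU|nVU] := pselect (V U); last first.
      by have [x _] := Vn0 _ VV0; exists x.
    apply: contrapT => nx; apply: nG; exists U => // x Ux.
    by apply: contrapT => nGx; apply: nx; exists x.
  have [||A AE] := @finite_hyperspace (f @` V).
  - exact: finite_image.
  - by exists (f V0), V0.
  have /VC[_ /(_ G CG)[x []]] : vietoris_base V A.
    split; rewrite AE.
      by move=> _ [U VU <-]; exists U => //; have [] := fP U VU.
    by move=> U VU; exists (f U); split; [exists U | have [] := fP U VU].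
  by rewrite AE => -[U VU <-]; have [] := fP U VU.
move=> U VU x Ux.
have /choice[f fP] : forall U', exists y, V U' -> U' y.
  move=> U'; have [VU'|nVU'] := pselect (V U'); last by exists x.
  by have [y] := Vn0 U' VU'; exists y.
have [||A AE] := @finite_hyperspace (x |` f @` V).
- by rewrite finite_setU; split; [exact: finite_set1 | exact: finite_image].
- by exists x; left.
have /VC[+ _] : vietoris_base V A.
  split; rewrite AE.
    by move=> _ [->|[U' VU' <-]]; [exists U | exists U' => //; exact: fP].
  by move=> U' VU'; exists (f U'); split; [right; exists U' | exact: fP].
by apply; rewrite AE; left.
Qed.

(** The common point is a finite set: from each member of either family, one point shared with a
    member of the other. *)
Lemma vietoris_base_meet V W : finite_set V -> V !=set0 -> finite_set W ->
  (forall U, V U -> exists2 G, W G & U `&` G !=set0) ->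
  (forall G, W G -> exists2 U, V U & U `&` G !=set0) ->
  vietoris_base V `&` vietoris_base W !=set0.
Proof.
move=> Vfin [V0 VV0] Wfin VW WV.
have [G0 _ [x0 _]] := VW V0 VV0.
have /choice[f fP] : forall U, exists x, V U ->
    U x /\ exists2 G, W G & G x.
  move=> U; have [VU|nVU] := pselect (V U); last by exists x0.
  by have [G WG [x [Ux Gx]]] := VW U VU; exists x => _; split => //; exists G.
have /choice[g gP] : forall G, exists x, W G ->
    G x /\ exists2 U, V U & U x.
  move=> G; have [WG|nWG] := pselect (W G); last by exists x0.
  by have [U VU [x [Ux Gx]]] := WV G WG; exists x => _; split => //; exists U.
have [||A AE] := @finite_hyperspace (f @` V `|` g @` W).
- by rewrite finite_setU; split; exact: finite_image.
- by exists (f V0); left; exists V0.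
exists A; split; split; rewrite AE.
- move=> _ [[U VU <-]|[G WG <-]]; first by exists U => //; case: (fP U VU).
  by have [_ []] := gP G WG => U; exists U.
- by move=> U VU; exists (f U); split; [left; exists U | case: (fP U VU)].
- move=> _ [[U VU <-]|[G WG <-]]; last by exists G => //; case: (gP G WG).
  by have [_ []] := fP U VU => G; exists G.
- by move=> G WG; exists (g G); split; [right; exists G | case: (gP G WG)].
Qed.

End FiniteSubsets.

(** * A winning strategy on the hyperspace *)

Section HyperspaceStrategy.
Variable Y : topologicalType.
Variable sigma : seq (set (set Y)) -> set (set Y).
Variable v : set (hyperspace Y) -> set (set Y).

(* Finite stages of a family of open sets of [Y] closed under non-empty
   binary intersections and under [sigma], and containing [v O] for each
   answer [O] of Player II; the most recent answer is the head of [s]. *)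
Fixpoint stage (s : seq (set (set (hyperspace Y)))) : set (set Y) :=
  if s is B :: s' then
    stage s' `|` \bigcup_(O in B) v O
    `|` [set U `&` V | U in stage s' & V in stage s'] `&` [set W | W !=set0]
    `|` \bigcup_(t in bounded_seqs (size s') [set F | F `<=` stage s']) sigma t
  else set0.

(** Offering every basic set over the current stage avoids bookkeeping: a finite part of the limit
    family is offered at all late rounds. [rev] puts the latest answer first, as [stage] expects. *)
Definition hyperspace_strategy (s : seq (set (set (hyperspace Y)))) :
    set (set (hyperspace Y)) :=
  [set vietoris_base C |
    C in [set C | C `<=` stage (rev s) /\ C !=set0]].

Hypothesis T1 : accessible_space Y.
Hypothesis sigma_win : winning_strategy sigma.
Hypothesis vP : forall O, open O -> O !=set0 ->
  [/\ vietoris_index (v O), vietoris_base (v O) !=set0 &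
    vietoris_base (v O) `<=` O].

Let v_nonempty O U : open O -> O !=set0 -> v O U -> U !=set0.
Proof.
move=> oO O0 vU; have [_ [A [_ /(_ U vU)[x [_ Ux]]]] _] := vP oO O0.
by exists x.
Qed.

(** Finiteness rests on the length bound [size s'] for the sequences fed to [sigma]. *)
Lemma stage_open_family s :
  (forall B, B \in s -> open_family B) -> open_family (stage s).
Proof.
elim: s => [_|B s IHs sP]; first by split.
have [Bfin Bo] : open_family B by apply: sP; rewrite mem_head.
have [Sfin So] : open_family (stage s).
  by apply: IHs => C Cs; apply: sP; rewrite in_cons Cs orbT.
have sigmaS t : bounded_seqs (size s) [set F | F `<=` stage s] t ->
    open_family (sigma t).
  move=> [_ tS]; apply: sigma_win.1 => F /tS FS; split.
    exact: sub_finite_set FS Sfin.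
  by move=> U /FS/So.
split => /=.
  rewrite !finite_setU; split; first split; first split => //.
  - by apply: bigcup_finite => // O /Bo[oO O0]; have [[]] := vP oO O0.
  - apply: sub_finite_set (finite_image2 setI Sfin Sfin).
    by move=> U [].
  - apply: bigcup_finite => [|t /sigmaS[]//].
    exact/finite_bounded_seqs/finite_powerset.
move=> U [[[/So//|[O BO vU]]|[[U1 S1 [U2 S2 <-]] U0]]|[t /sigmaS[_ +] tU]].
- have [oO O0] := Bo O BO; split; last exact: v_nonempty vU.
  by have [[_ _ +] _ _] := vP oO O0; exact.
- by split => //; apply: openI; [case: (So _ S1) | case: (So _ S2)].
- exact.
Qed.

Lemma hyperspace_strategyP : strategy hyperspace_strategy.
Proof.
move=> s sP; have [|Sfin So] := @stage_open_family (rev s).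
  by move=> B; rewrite mem_rev; exact: sP.
split.
  apply: finite_image; apply: sub_finite_set (finite_powerset Sfin).
  by move=> C [].
move=> _ [C [CS C0] <-]; split.
  apply: vietoris_base_open; split => //; first exact: sub_finite_set CS Sfin.
  by move=> U /CS/So[].
have Cfin := sub_finite_set CS Sfin.
(* Non-emptiness comes from [vietoris_base_meet] applied to [C] twice. *)
have [A []] : vietoris_base C `&` vietoris_base C !=set0; last by exists A.
have CC U : C U -> exists2 G, C G & U `&` G !=set0.
  by move=> CU; exists U => //; rewrite setIid; have [] := So U (CS U CU).
by apply: vietoris_base_meet => // G /CC[U CU UG]; exists U; rewrite // setIC.
Qed.

Lemma hyperspace_strategy_wins : winning_strategy hyperspace_strategy.
Proof.
split; first exact: hyperspace_strategyP.
move=> B BP k O O0 oO.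
pose S n := stage (rev (mkseq B n)).
have S_S n : S n.+1 = stage (B n :: rev (mkseq B n)).
  by rewrite /S mkseqS rev_rcons.
have Smon m n : (m <= n)%N -> S m `<=` S n.
  elim: n => [|n IHn]; first by rewrite leqn0 => /eqP ->.
  rewrite leq_eqVlt => /predU1P[->//|/IHn mn] U /mn SU.
  by rewrite S_S; left; left; left.
have So n : open_family (S n).
  apply: stage_open_family => C; rewrite mem_rev => /mapP[i _ ->].
  by have [] := BP i.
pose P := \bigcup_n S n.
have Po U : P U -> open U /\ U !=set0 by move=> [n _]; apply (So n).2.
have PI U V : P U -> P V -> U `&` V !=set0 -> P (U `&` V).
  move=> [m _ SU] [n _ SV] UV; exists (maxn m n).+1 => //.
  rewrite S_S; left; right; split => //.
  exists U; first exact: Smon (leq_maxl _ _) _ SU.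
  by exists V => //; exact: Smon (leq_maxr _ _) _ SV.
have Psigma t : (forall F, F \in t -> finite_set F /\ F `<=` P) ->
    sigma t `<=` P.
  move=> tP; have [||n tn] := @seq_nondecreasing_property _
      (fun n (F : set (set Y)) => F `<=` S n) t.
  - by move=> m n F /Smon mn /subset_trans; apply.
  - by move=> F /tP[Ffin FP]; exact: finite_subset_nondecreasing_bigcup.
  (* The stage must contain the families in [t] and also admit sequences of length [size t];
     [sigma t] enters one stage later. *)
  move=> U sU; exists (maxn n (size t)).+1 => //.
  rewrite S_S; right; exists t => //; split.
    by rewrite size_rev size_mkseq leq_maxr.
  by move=> F /tn/subset_trans; apply; exact/Smon/leq_maxl.
have [W [[Wfin W0 Wo] [A WA] WO]] := vietoris_open_base oO O0.
have /choice[u uP] : forall G, exists U, W G ->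
    P U /\ forall U', P U' -> U' `<=` U -> U' `&` G !=set0.
  move=> G; have [WG|] := pselect (W G); last by exists G.
  have [||U PU UG] := winning_strategy_closed_family (V := G) sigma_win Po
    Psigma.
  - exact: Wo.
  - by have [_ /(_ G WG)[x [_ Gx]]] := WA; exists x.
  by exists U.
have [||m uS] := @finite_subset_nondecreasing_bigcup _ S (u @` W) Smon.
- exact: finite_image.
- by move=> _ [G WG <-]; exact: (uP G WG).1.
pose n := maxn k m.
have [[_ Bo] Bref] := BP n.
have [|O' BO' O'u] := Bref (vietoris_base (u @` W)).
  exists (u @` W) => //; split.
    exact: subset_trans uS (Smon _ _ (leq_maxr _ _)).
  by have [G WG] := W0; exists (u G), G.
have [oO' O'0] := Bo O' BO'.
have [[vfin v0 _] _ vO'] := vP oO' O'0.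
have vn0 U : v O' U -> U !=set0 by exact: v_nonempty.
have [vref vcov] :=
  vietoris_base_subset T1 vfin v0 vn0 (subset_trans vO' O'u).
have Pv : v O' `<=` P.
  by move=> U vU; exists n.+1 => //; rewrite S_S; left; left; right; exists O'.
(* A member [U] of [v O'] meets some [u G], and their intersection is in [P] below [u G], hence
   meets [G]. Conversely each [u G] contains a member of [v O'], which meets [G]. *)
have [||D [vD WD]] := vietoris_base_meet T1 vfin v0 Wfin.
- move=> U vU; have [x Ux] := vn0 U vU.
  have [_ [G WG <-] uGx] := vcov U vU x Ux.
  have [PuG uG] := uP G WG; exists G => //.
  have [||y [[Uy _] Gy]] := uG (U `&` u G).
  + by apply: PI => //; [exact: Pv | exists x].
  + by move=> ? [].
  by exists y.
- move=> G WG; have [PuG uG] := uP G WG.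
  have [U vU UuG] := vref (u G) (ex_intro2 _ _ G WG erefl).
  by exists U => //; apply: uG => //; exact: Pv.
exists D; split; first exact: WO.
exists n; first exact: leq_maxl.
by exists O' => //; exact: vO'.
Qed.

End HyperspaceStrategy.

Theorem I_favorable_hyperspace (Y : topologicalType) :
  accessible_space Y -> I_favorable Y -> I_favorable (hyperspace Y).
Proof.
move=> T1 [sigma sigma_win].
have /choice[v vP] : forall O : set (hyperspace Y), exists V,
    open O -> O !=set0 -> [/\ vietoris_index V, vietoris_base V !=set0 &
      vietoris_base V `<=` O].
  move=> O; have [[oO O0]|nO] := pselect (open O /\ O !=set0).
    by have [V VP] := vietoris_open_base oO O0; exists V.
  by exists set0 => oO O0; case: nO.
by exists (hyperspace_strategy sigma v); exact: hyperspace_strategy_wins.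
Qed.

Theorem theorem9 (Y : topologicalType) (hT1 : accessible_space Y)
  (hcompact : compact [set: Y]) (hI : I_favorable Y) :
  uKU_star (hyperspace Y).
Proof. exact/I_favorable_uKU_star/I_favorable_hyperspace. Qed.
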